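(* The opposite $\mathbf{CoAlg}(\mathbb{V})^{\mathrm{op}}$ of the category of coalgebras for the Vietoris functor on compact Hausdorff spaces is monadic over $\mathbf{Set}$. More precisely, the functor $\mathbf{CoAlg}(\mathbb{V})^{\mathrm{op}}\to\mathbf{Set}$ sending a coalgebra $(X, f\colon X\to\mathbb{V}X)$ to the set $\hom_{\mathbf{CH}}(X,[0,1])$ and sending a coalgebra morphism $g\colon X_1\to X_2$ to the precomposition map $h\mapsto h\circ g$ from $\hom_{\mathbf{CH}}(X_2,[0,1])$ to $\hom_{\mathbf{CH}}(X_1,[0,1])$ is monadic.
   Context: $\mathbf{CH}$ denotes the category of compact Hausdorff spaces and continuous maps; $[0,1]$ carries the Euclidean topology. For a compact Hausdorff space $X$, $\mathbb{V}X$ is the set of all closed subsets of $X$ (including $\varnothing$) with the Vietoris topology, generated by the sets $\Box U=\{K\mid K\subseteq U\}$ and $\Diamond U=\{K\mid K\cap U\neq\varnothing\}$ for $U$ open in $X$; it is compact Hausdorff. For continuous $f\colon X\to Y$, $\mathbb{V}f(K)=f[K]$. For an endofunctor $F$ on a category $\mathbf{C}$, $\mathbf{CoAlg}(F)$ has objects $(X, f\colon X\to FX)$ and morphisms $(X_1,f_1)\to(X_2,f_2)$ the maps $g\colon X_1\to X_2$ in $\mathbf{C}$ with $Fg\circ f_1=f_2\circ g$. *)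

(* Defs.v *)
From HB Require Import structures.
From mathcomp Require Import all_boot all_order all_algebra.
From mathcomp Require Import all_classical all_reals all_analysis.
Import numFieldNormedType.Exports.
Set Implicit Arguments. Unset Strict Implicit. Unset Printing Implicit Defensive.
Import Order.TTheory GRing.Theory Num.Theory.
Local Open Scope classical_set_scope.
Local Open Scope ring_scope.

Definition vietoris (X : topologicalType) := {K : set X | closed K}.
HB.instance Definition _ (X : topologicalType) := gen_eqMixin (vietoris X).
HB.instance Definition _ (X : topologicalType) := gen_choiceMixin (vietoris X).

Definition vietoris_subbase (X : topologicalType) (p : bool * set X) :
  set (vietoris X) :=
  if p.1 then [set K | sval K `<=` p.2]
  else [set K | sval K `&` p.2 !=set0].

HB.instance Definition _ (X : topologicalType) :=
  isSubBaseTopological.Build (vietoris X)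
    [set p : bool * set X | open p.2] (@vietoris_subbase X).

Record coalg := Coalg {
  cX : topologicalType;
  cX_compact : compact [set: cX];
  cX_hausdorff : hausdorff_space cX;
  cstr : cX -> vietoris cX;
  cstr_cont : continuous cstr }.

Definition coalg_mor (A B : coalg) (g : cX A -> cX B) : Prop :=
  continuous g /\ forall x, g @` sval (@cstr A x) = sval (@cstr B (g x)).

Definition hom (A B : coalg) := {g : cX A -> cX B | @coalg_mor A B g}.

Definition Uob (R : realType) (A : coalg) :=
  {h : cX A -> R | continuous h /\ forall x, 0 <= h x <= 1}.

Lemma Umor_proof (R : realType) (A B : coalg) (g : hom A B) (h : Uob R B) :
  continuous (sval h \o sval g) /\ forall x, 0 <= (sval h \o sval g) x <= 1.
Proof.
have [gc _] := proj2_sig g; have [hc h01] := proj2_sig h.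
split => /=; last by move=> x; exact: h01.
by move=> x; apply: continuous_comp; [exact: gc|exact: hc].
Qed.

Definition Umor (R : realType) (A B : coalg) (g : hom A B) : Uob R B -> Uob R A :=
  fun h => exist _ (sval h \o sval g) (Umor_proof g h).

(** Monadicity of U : CoAlg(V)^op -> Set, written out:
    U has a left adjoint F (given by universal arrows eta_S : S -> U(F S),
    with [lift] the induced morphisms), and the comparison functor
    K : CoAlg(V)^op -> EM(U F), A |-> (U A, U eps_A), is an equivalence
    (fully faithful and essentially surjective). *)
Definition U_monadic (R : realType) : Prop :=
  exists (F : Type -> coalg) (eta : forall S : Type, S -> Uob R (F S))
         (lift : forall (S : Type) (A : coalg), (S -> Uob R A) -> hom A (F S)),
  (forall S A (phi : S -> Uob R A), Umor (lift S A phi) \o eta S =1 phi) /\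
  (forall S A (phi : S -> Uob R A) (g : hom A (F S)),
      Umor g \o eta S =1 phi -> sval g = sval (lift S A phi)) /\
  let T := fun S : Type => Uob R (F S) in
  let Tmap := fun (S S' : Type) (s : S -> S') =>
                Umor (lift S (F S') (eta S' \o s)) : T S -> T S' in
  let mu := fun S : Type => Umor (lift (T S) (F S) id) : T (T S) -> T S in
  let epsU := fun A : coalg => Umor (lift (Uob R A) A id) : T (Uob R A) -> Uob R A in
  let is_alg := fun (Y : Type) (a : T Y -> Y) =>
                  a \o eta Y =1 id /\ a \o Tmap _ _ a =1 a \o mu Y in
  let is_alg_mor := fun (Y Y' : Type) (a : T Y -> Y) (a' : T Y' -> Y')
                        (p : Y -> Y') => p \o a =1 a' \o Tmap _ _ p in
  (forall (A B : coalg) (g1 g2 : hom B A),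
      @Umor R _ _ g1 =1 @Umor R _ _ g2 -> sval g1 = sval g2) /\
  (forall (A B : coalg) (p : Uob R A -> Uob R B),
      is_alg_mor _ _ (epsU A) (epsU B) p ->
      exists g : hom B A, @Umor R _ _ g =1 p) /\
  (forall (Y : Type) (a : T Y -> Y), is_alg Y a ->
      exists (A : coalg) (p : Uob R A -> Y) (q : Y -> Uob R A),
        cancel p q /\ cancel q p /\ is_alg_mor _ _ (epsU A) a p).

(* Main.v *)
Require Import Defs.
From mathcomp Require Import all_boot all_order all_algebra.
From mathcomp Require Import all_classical all_reals all_analysis.
Import numFieldNormedType.Exports.
Set Implicit Arguments. Unset Strict Implicit. Unset Printing Implicit Defensive.
Import Order.TTheory GRing.Theory Num.Theory.
Local Open Scope classical_set_scope.
Local Open Scope ring_scope.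

(* The left adjoint sends S to the cofree coalgebra over [0,1]^S.  It is built
   from real-valued modal formulas with variables in S and a modality Dia,
   where (Dia f) x is the supremum of f over the successors of x: its points are
   the valuations of formulas in the largest set closed under taking witnesses
   for Dia, and s is a successor of t when s f <= t (Dia f) for all f.  That
   largest set is closed in [0,1]^formula, since the closure of a set with
   witnesses has witnesses by compactness, and the universal map sends a point of
   a coalgebra to its theory.

   Monadicity is then verified directly.  Points are separated by functions into
   [0,1], and a morphism of algebras UA -> UB gives B -> F(UA) with image in the
   embedded copy of A.  An algebra a on Y is presented by the equalizer of the
   coreflexive pair F Y => F(T Y) that corresponds to id and to eta o a.  Such an
   equalizer is a subcoalgebra because of the common retraction, and by Tietze's
   theorem hom(-, [0,1]) turns it into a coequalizer. *)

(** * Continuity into initial, product and Vietoris topologies *)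

Lemma continuous_initial (S : choiceType) (X T : topologicalType) (f : S -> T)
    (g : X -> initial_topology f) : continuous (f \o g) -> continuous g.
Proof.
move=> /continuousP fgc; apply/continuousP => A [B oB <-].
by rewrite -comp_preimage; exact: fgc.
Qed.

Lemma continuous_prod (I : Type) (X : topologicalType)
    (T : I -> topologicalType) (g : X -> prod_topology T) :
  (forall i, continuous (fun x => g x i)) -> continuous g.
Proof.
move=> gc x; apply/cvg_sup => i A [B [[C oC <-]] Cgx BA].
apply: (filterS BA); apply: (gc i x); exact: open_nbhs_nbhs.
Qed.

Lemma proj_prod_continuous (I : Type) (T : I -> topologicalType) (i : I) :
  continuous (fun f : prod_topology T => f i).
Proof. exact: (@proj_continuous {classic I} T i). Qed.

Lemma open_subbase (X : topologicalType) (p : bool * set X) :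
  open p.2 -> open (vietoris_subbase p).
Proof.
move=> op; exists [set vietoris_subbase p]; last by rewrite bigcup_set1.
by move=> _ ->; exact: finI_from1.
Qed.

Lemma open_box (X : topologicalType) (U : set X) :
  open U -> open [set K : vietoris X | sval K `<=` U].
Proof. exact: (@open_subbase _ (true, U)). Qed.

Lemma open_diamond (X : topologicalType) (U : set X) :
  open U -> open [set K : vietoris X | sval K `&` U !=set0].
Proof. exact: (@open_subbase _ (false, U)). Qed.

Lemma continuous_vietoris (X Z : topologicalType) (g : Z -> vietoris X) :
  (forall U, open U -> open [set z | sval (g z) `<=` U]) ->
  (forall U, open U -> open [set z | sval (g z) `&` U !=set0]) ->
  continuous g.
Proof.
move=> gb gd; apply/continuousP => A [D DI <-].
rewrite preimage_bigcup; apply: bigcup_open => B /DI [J JD <-].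
rewrite preimage_bigcap openE => z Jz; apply: filter_bigI => p Jp.
suff: open (g @^-1` vietoris_subbase p) by rewrite openE; apply; exact: Jz.
have /= := JD _ Jp; rewrite inE => {Jp}.
by case: p => -[] U oU; [exact: gb|exact: gd].
Qed.

Lemma closed_image (X Y : topologicalType) (f : X -> Y) (C : set X) :
  compact [set: X] -> hausdorff_space Y -> continuous f -> closed C ->
  closed (f @` C).
Proof.
move=> cX hY fc cC; apply: compact_closed => //.
apply: continuous_compact; first exact: continuous_subspaceT.
exact: (subclosed_compact cC cX).
Qed.

(** * Compact Hausdorff subspaces as types *)

Section subspace_type.
Variables (X : topologicalType) (K : set X).

Lemma set_val_continuous : continuous (@set_val X K : K -> X).
Proof. exact: initial_continuous. Qed.

Lemma continuous_set_val (Z : topologicalType) (g : Z -> K) :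
  continuous (set_val \o g) -> continuous g.
Proof. exact: continuous_initial. Qed.

Lemma set_type_hausdorff : hausdorff_space X -> hausdorff_space K.
Proof.
move=> hX x y xy; apply: val_inj; apply: hX => A B Ax By.
have [z [Az Bz]] := xy _ _ (set_val_continuous Ax) (set_val_continuous By).
by exists (set_val z).
Qed.

Lemma set_type_compact : compact K -> compact [set: K].
Proof.
move=> cK F PF _.
have PG := fmap_proper_filter (set_val : K -> X) PF.
have GK : (set_val @ F) K by apply: (@filterE _ F) => x; exact: set_valP.
have [x [Kx Fx]] := cK _ PG GK.
exists (SigSub (mem_set Kx)); split => // A B FA [_ [[C oC <-] Cx] CB].
have GA : (set_val @ F) (set_val @` A).
  by apply: (@filterS _ F _ A) FA; exact: preimage_image.
have [_ [[y Ay <-] Cy]] := Fx _ _ GA (open_nbhs_nbhs (conj oC Cx)).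
by exists y; split => //; exact: CB.
Qed.

End subspace_type.

Lemma closed_set1_hausdorff (X : topologicalType) (x : X) :
  hausdorff_space X -> closed [set x].
Proof. by move=> hX; apply: accessible_closed_set1; exact: hausdorff_accessible. Qed.

(** * Urysohn and Tietze for functions into [0,1] *)

Section real_valued.
Variables (R : realType) (X : topologicalType).
Hypotheses (cX : compact [set: X]) (hX : hausdorff_space X).

Lemma urysohn01 (A : set X) (x : X) : closed A -> ~ A x ->
  exists h : X -> R, [/\ continuous h, forall y, 0 <= h y <= 1,
    forall y, A y -> h y = 0 & h x = 1].
Proof.
move=> cA nAx.
have /normal_separatorP nX := compact_normal hX cX.
have /(@uniform_separatorP _ R) [h [hc h01 h0 h1]] :
    uniform_separator A [set x].
  apply: (nX R) => //; first exact: closed_set1_hausdorff.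
  by apply/seteqP; split => // y [Ay /= yx]; apply: nAx; rewrite -yx.
exists h; split => //.
- by move=> y; have := h01 (h y) (imageT _ _); rewrite /= in_itv.
- by move=> y Ay; apply: h0; exists y.
- by apply: h1; exists x.
Qed.

Lemma tietze01 (A : set X) (f : X -> R) : closed A ->
  {within A, continuous f} -> (forall x, A x -> 0 <= f x <= 1) ->
  exists h : X -> R, [/\ continuous h, forall x, 0 <= h x <= 1 &
    forall x, A x -> h x = f x].
Proof.
move=> cA fc f01.
have [x Ax|g [fg gc _]] := continuous_bounded_extension
  (compact_normal hX cX) cA (ltr01 : 0 < 1 :> R) fc.
  by have /andP[f0 f1] := f01 _ Ax; rewrite ger0_norm.
(* The extension is only bounded by 1 in absolute value, so it is truncated to [0,1]; on [A] nothing
   changes. *)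
exists (fun x => Num.max 0 (Num.min 1 (g x))); split.
- move=> x; apply: (@continuous_max R X (cst 0) (cst 1 \min g)).
    exact: cst_continuous.
  by apply: (@continuous_min R X (cst 1) g); [exact: cst_continuous|exact: gc].
- by move=> x; rewrite le_max lexx/= ge_max ler01/= ge_min lexx.
- move=> x Ax; rewrite -fg ?inE//; have /andP[f0 f1] := f01 _ Ax.
  by rewrite min_r// max_r.
Qed.

(** A continuous injection of a compact space into a Hausdorff one is a closed embedding, so [h]
    becomes a continuous function on the closed set [range i], to which Tietze's theorem applies. *)
Lemma extension01 (A : topologicalType) (i : A -> X) (h : A -> R) :
  compact [set: A] -> continuous i -> injective i ->
  continuous h -> (forall a, 0 <= h a <= 1) ->
  exists h' : X -> R, [/\ continuous h', forall x, 0 <= h' x <= 1 &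
    forall a, h' (i a) = h a].
Proof.
move=> cA ic ii hc h01.
pose f x := if pselect (exists a, i a = x) is left e then h (sval (cid e)) else 0.
have fi a : f (i a) = h a.
  by rewrite /f; case: pselect => [e|[]]; [rewrite (ii _ _ (svalP (cid e)))|exists a].
have cli C : closed C -> closed (i @` C) by exact: closed_image.
have [|| |h' [h'c h'01 h'f]] := @tietze01 (range i) f.
- exact: cli.
- apply/continuous_closedP => C cC.
  rewrite -closed_setIS; last exact: cli.
  rewrite (_ : _ `&` _ = i @` (h @^-1` C)).
    by apply: cli; move/continuous_closedP: hc; exact.
  apply/seteqP; split => [x [Cfx [a _ ax]]|_ [a Ca <-]].
    by exists a => //; rewrite /preimage/= -fi ax.
  split; last by exists a.
  by change (C (f (i a))); rewrite fi.
- by move=> _ [a _ <-]; rewrite fi.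
by exists h'; split => // a; rewrite h'f ?fi.
Qed.

End real_valued.

(** * Suprema over sets: the semantics of the modality *)

Section sup_image.
Variables (R : realType) (X : Type).
Implicit Types (K : set X) (h : X -> R).

Lemma sup_image_ub K h x : (forall x, 0 <= h x <= 1) -> K x ->
  h x <= sup (h @` K).
Proof.
move=> h01 Kx; apply: ub_le_sup; last by exists x.
by exists 1 => _ [y _ <-]; have /andP[] := h01 y.
Qed.

(** The bound [0 <= c] is for empty [K], where the supremum is 0 by convention. *)
Lemma sup_image_le K h c : 0 <= c -> (forall x, K x -> h x <= c) ->
  sup (h @` K) <= c.
Proof.
move=> c0 hc; have [->|/set0P K0] := eqVneq (h @` K) set0; first by rewrite sup0.
by apply: ge_sup => // _ [x Kx <-]; exact: hc.
Qed.

Lemma sup_image_ge0 K h : (forall x, 0 <= h x <= 1) -> 0 <= sup (h @` K).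
Proof.
move=> h01; have [->|/set0P [_ [x Kx _]]] := eqVneq (h @` K) set0.
  by rewrite sup0.
by apply: le_trans (sup_image_ub h01 Kx); have /andP[] := h01 x.
Qed.

Lemma sup_image01 K h : (forall x, 0 <= h x <= 1) -> 0 <= sup (h @` K) <= 1.
Proof.
move=> h01; rewrite sup_image_ge0//=; apply: sup_image_le => // x _.
by have /andP[] := h01 x.
Qed.

Lemma sup_image_adherent K h c : (forall x, 0 <= h x <= 1) ->
  0 <= c < sup (h @` K) -> exists2 x, K x & c < h x.
Proof.
move=> h01 /andP[c0]; apply: contraPP => /forall2NP nx; apply/negP.
rewrite -leNgt; apply: sup_image_le => // x Kx.
by have [//|/negP] := nx x; rewrite -leNgt.
Qed.

End sup_image.

Lemma sup_image_attained (R : realType) (X : topologicalType) (K : set X)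
    (h : X -> R) : compact K -> continuous h -> (forall x, 0 <= h x <= 1) ->
  0 < sup (h @` K) -> exists2 x, K x & h x = sup (h @` K).
Proof.
move=> cK hc h01 s0.
have [x Kx _] := sup_image_adherent h01 (introT andP (conj (lexx 0) s0)).
have [||c /set_mem Kc cmax] := compact_EVT_max (f := h) _ cK.
- by exists x.
- exact: continuous_subspaceT.
exists c => //; apply/eqP; rewrite eq_le sup_image_ub//=.
apply: sup_image_le => [|y Ky]; first by have /andP[] := h01 c.
by apply: cmax; rewrite inE.
Qed.

(** An upper bound on the supremum is a box condition for the open set where h < s + e, a lower
    bound a diamond condition for the open set where h > s - e; both persist near [z]. *)
Lemma sup_image_continuous (R : realType) (X Z : topologicalType)
    (g : Z -> vietoris X) (h : X -> R) : continuous g -> continuous h ->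
  (forall x, 0 <= h x <= 1) -> continuous (fun z => sup (h @` sval (g z))).
Proof.
move=> gc hc h01 z; apply/cvgrPdist_le => e e0.
set s := sup _.
have near_open W : open W -> W (g z) -> \forall z' \near z, W (g z').
  by move=> oW Wz; apply: (gc z); exact: open_nbhs_nbhs.
have upper : \forall z' \near z, sup (h @` sval (g z')) <= s + e.
  have : \forall z' \near z, sval (g z') `<=` h @^-1` [set r | r < s + e].
    apply: (near_open _ (open_box _)) => /=; last first.
      by move=> x Kx; rewrite /= (le_lt_trans (sup_image_ub h01 Kx))// ltrDl.
    by apply: open_comp => [x _|]; [exact: hc|exact: open_lt].
  apply: filterS => z' K; apply: sup_image_le => [|x Kx].
    by rewrite addr_ge0 ?(ltW e0)// sup_image_ge0.
  exact/ltW/K.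
have lower : \forall z' \near z, s - e <= sup (h @` sval (g z')).
  (* A negative bound holds trivially; this case includes an empty [g z], for which no diamond
     condition is available. *)
  have [se|se] := ltP (s - e) 0.
    by apply: nearW => z'; rewrite (le_trans (ltW se))// sup_image_ge0.
  have [|x Kx hx] := @sup_image_adherent _ _ (sval (g z)) h (s - e) h01.
    by rewrite se/= ltrBlDr ltrDl.
  have : \forall z' \near z,
      sval (g z') `&` (h @^-1` [set r | s - e < r]) !=set0.
    apply: (near_open _ (open_diamond _)) => /=; last by exists x.
    by apply: open_comp => [y _|]; [exact: hc|exact: open_gt].
  by apply: filterS => z' [y [Ky /ltW/le_trans]]; apply; exact: sup_image_ub.
near=> z'; rewrite ler_distlC.
by apply/andP; split; near: z'.
Unshelve. all: by end_near.
Qed.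

(** * Closed sets given by equations and inequalities *)

Lemma closure_sub_closed (X : topologicalType) (C D : set X) :
  C `<=` D -> closed D -> closure C `<=` D.
Proof. by move=> CD /closure_id ->; exact: closure_subset. Qed.

Lemma closed_preimage (X Y : topologicalType) (f : X -> Y) (D : set Y) :
  continuous f -> closed D -> closed (f @^-1` D).
Proof. by move=> /continuous_closedP; apply. Qed.

Lemma continuous_fst (X Y : topologicalType) : continuous (@fst X Y).
Proof. by move=> p; exact: cvg_fst. Qed.

Lemma continuous_snd (X Y : topologicalType) : continuous (@snd X Y).
Proof. by move=> p; exact: cvg_snd. Qed.

Lemma continuous_comp_fst (X Y Z : topologicalType) (f : X -> Z) :
  continuous f -> continuous (fun p : X * Y => f p.1).
Proof.
by move=> fc p; apply: continuous_comp; [exact: continuous_fst|exact: fc].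
Qed.

Lemma continuous_comp_snd (X Y Z : topologicalType) (f : Y -> Z) :
  continuous f -> continuous (fun p : X * Y => f p.2).
Proof.
by move=> fc p; apply: continuous_comp; [exact: continuous_snd|exact: fc].
Qed.

Section closed_relations.
Variables (R : realType) (X : topologicalType) (a b : X -> R).
Hypotheses (ac : continuous a) (bc : continuous b).

Lemma closed_le_fun : closed [set x | a x <= b x].
Proof.
rewrite (_ : mkset _ = (b \- a) @^-1` [set r | 0 <= r]).
  apply: closed_preimage; last exact: closed_ge.
  move=> x.
  by apply: (@continuousB _ R^o); [exact: bc|exact: ac].
by apply/seteqP; split => x /=; rewrite subr_ge0.
Qed.

End closed_relations.

Lemma closed_eq_fun (R : realType) (X : topologicalType) (a b : X -> R) :
  continuous a -> continuous b -> closed [set x | a x = b x].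
Proof.
move=> ac bc; rewrite (_ : mkset _ = [set x | a x <= b x] `&` [set x | b x <= a x]).
  by apply: closedI; exact: closed_le_fun.
apply/seteqP; split => x /=; first by move=> ->.
by move=> [ab ba]; apply: le_anti; rewrite ab.
Qed.


Lemma Uob_ext (R : realType) (A : coalg) (h k : Uob R A) :
  sval h =1 sval k -> h = k.
Proof. by case: h k => [h hp] [k kp] /funext hk; exact: eq_exist. Qed.

(** * Real-valued modal formulas *)

Section cofree.
Variable R : realType.

(** A bump of height 1 at [r] whose width is set by [e]. As a connective it turns a difference
    between two values into the difference between 1 and 0. *)
Definition tent (r e x : R) : R := Num.max 0 (1 - `|(x - r) * e|).

Lemma tent_continuous r e : continuous (tent r e).
Proof.
move=> x; apply: (@continuous_max R R (cst 0) (fun x => 1 - `|(x - r) * e|)).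
  exact: cst_continuous.
apply: (@continuousB _ R^o R (cst 1) (fun x => `|(x - r) * e|)).
  exact: cst_continuous.
apply: (@continuous_comp _ _ _ (fun x => (x - r) * e) Num.norm); last first.
  exact: (@norm_continuous _ R^o).
apply: (@continuousM _ R (fun x => x - r) (cst e)); last exact: cst_continuous.
by apply: (@continuousB _ R^o R id (cst r)); [exact: cvg_id|exact: cst_continuous].
Qed.

Lemma tent01 r e x : 0 <= tent r e x <= 1.
Proof. by rewrite le_max lexx/= ge_max ler01/= gerBl. Qed.

Lemma min01 (x y : R) : 0 <= x <= 1 -> 0 <= y <= 1 -> 0 <= Num.min x y <= 1.
Proof. by move=> /andP[x0 x1] /andP[y0 _]; rewrite le_min x0 y0 ge_min x1. Qed.

Lemma tent_center r e : tent r e r = 1.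
Proof. by rewrite /tent subrr mul0r normr0 subr0 max_r. Qed.

Lemma tent_apart r x : x != r -> tent r (x - r)^-1 x = 0.
Proof.
by rewrite -subr_eq0 => xr; rewrite /tent divff// normr1 subrr maxxx.
Qed.

Variable S : Type.

(** Beyond variables and the modality, the connectives serve to separate points from closed sets:
    [Top] and [Min] make the formulas of value 1 at a point a filter base, and [Tent] tells two
    values apart. *)
Inductive formula :=
| Var of S
| Top
| Min of formula & formula
| Tent of R & R & formula
| Dia of formula.

(** * Valuations and the largest set with witnesses *)

Definition valuation : topologicalType :=
  prod_topology (fun _ : formula => R : topologicalType).
Implicit Types (s t : valuation) (f g : formula).

Definition lawful t := [/\ forall f, 0 <= t f <= 1, t Top = 1,
  forall f g, t (Min f g) = Num.min (t f) (t g) &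
  forall r e f, t (Tent r e f) = tent r e (t f)].

Definition successor t s := forall f, s f <= t (Dia f).

(* The alternative [t (Dia f) = 0] covers the points without successors, where
   the supremum defining [Dia f] is [sup set0 = 0]. *)
Definition postfixed (C : set valuation) := forall t, C t -> lawful t /\
  forall f, t (Dia f) = 0 \/ exists s, [/\ C s, successor t s & s f = t (Dia f)].

(** The greatest postfixed set, as in the Knaster-Tarski theorem. *)
Definition behaviours : set valuation := \bigcup_(C in postfixed) C.

Lemma behaviours_postfixed : postfixed behaviours.
Proof.
move=> t [C Cp Ct]; have [lt ft] := Cp t Ct; split => // f.
by have [|[s [Cs ts e]]] := ft f; [left|right; exists s; split => //; exists C].
Qed.

Lemma eval_continuous f : continuous (fun t => t f).
Proof. exact: (@proj_prod_continuous _ (fun _ : formula => R : topologicalType)). Qed.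

Lemma valuation_hausdorff : hausdorff_space valuation.
Proof.
by apply: (@hausdorff_product {classic formula} (fun=> R)) => _; exact: Rhausdorff.
Qed.

Lemma cube_compact : compact [set t : valuation | forall f, 0 <= t f <= 1].
Proof.
rewrite (_ : mkset _ = [set t | forall f, `[0, 1]%classic (t f)]).
  apply: (@tychonoff {classic formula} (fun=> R) (fun=> `[0, 1]%classic)) => _.
  exact: segment_compact.
by apply/seteqP; split => t tf f; have := tf f; rewrite /= in_itv.
Qed.

Lemma closure_postfixed C : postfixed C -> postfixed (closure C).
Proof.
move=> Cp t Ct.
have lawC s : closure C s -> lawful s.
  move=> Cs; split.
  - move=> f; have : [set s | 0 <= s f] s /\ [set s | s f <= 1] s.
      split; apply: closure_sub_closed Cs.
      + by move=> u /Cp [[/(_ f)/andP[]]].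
      + by apply: closed_le_fun; [exact: cst_continuous|exact: eval_continuous].
      + by move=> u /Cp [[/(_ f)/andP[]]].
      + by apply: closed_le_fun; [exact: eval_continuous|exact: cst_continuous].
    by move=> /= [-> ->].
  - apply: (@closure_sub_closed _ C [set s | s Top = 1]) Cs.
      by move=> u /Cp [[]].
    by apply: closed_eq_fun; [exact: eval_continuous|exact: cst_continuous].
  - move=> f g.
    apply: (@closure_sub_closed _ C
      [set s | s (Min f g) = Num.min (s f) (s g)]) Cs.
      by move=> u /Cp [[_ _ + _] _]; exact.
    apply: closed_eq_fun; first exact: eval_continuous.
    move=> u; apply: (@continuous_min R valuation (fun s => s f) (fun s => s g)).
      exact: (@eval_continuous f u).
    exact: (@eval_continuous g u).
  - move=> r e f.
    apply: (@closure_sub_closed _ C [set s | s (Tent r e f) = tent r e (s f)]) Cs.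
      by move=> u /Cp [[_ _ _ +] _]; exact.
    apply: closed_eq_fun; first exact: eval_continuous.
    move=> u; apply: continuous_comp; [exact: eval_continuous|exact: tent_continuous].
split; [exact: lawC|move=> f].
(* Pairs of a point and a witness for [f]. Witnesses are sought in the closure of [C], which makes
   [steps] closed, hence compact in a product of two cubes. *)
pose steps := [set p : valuation * valuation | [/\ closure C p.1, closure C p.2,
  successor p.1 p.2 & p.2 f = p.1 (Dia f)]].
have ev1 g : continuous (fun p : valuation * valuation => p.1 g).
  exact: (continuous_comp_fst (@eval_continuous g)).
have ev2 g : continuous (fun p : valuation * valuation => p.2 g).
  exact: (continuous_comp_snd (@eval_continuous g)).
have steps_closed : closed steps.
  rewrite (_ : steps = fst @^-1` closure C `&` snd @^-1` closure C `&`
     (\bigcap_g [set p | p.2 g <= p.1 (Dia g)]) `&` [set p | p.2 f = p.1 (Dia f)]).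
    apply: closedI; last exact: closed_eq_fun.
    apply: closedI; last by apply: closed_bigI => g _; exact: closed_le_fun.
    by apply: closedI; apply: closed_preimage (@closed_closure _ C);
      [exact: continuous_fst|exact: continuous_snd].
  apply/seteqP; split => p.
    by move=> [? ? ps ?]; split => //; split => // g _; exact: ps.
  by move=> [[[? ?] ps] ?]; split => // g; exact: ps.
have steps_compact : compact steps.
  apply: (subclosed_compact steps_closed (compact_setX cube_compact cube_compact)).
  by move=> p [/lawC[? _ _ _] /lawC[? _ _ _] _ _].
(* Both alternatives define closed sets, the second as a projection of a compact set; together they
   cover [C], hence its closure. *)
suff : [set t | t (Dia f) = 0] t \/ (fst @` steps) t.
  by move=> [|[[t' s] /= [_ Cs ts e] <-]]; [left|right; exists s].
apply: (@closure_sub_closed _ C ([set t | t (Dia f) = 0] `|` fst @` steps)) Ct.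
  move=> u Cu; have [_ /(_ f)[|[s [Cs us e]]]] := Cp _ Cu; first by left.
  by right; exists (u, s) => //; split => //; exact: subset_closure.
apply: closedU.
  by apply: closed_eq_fun; [exact: eval_continuous|exact: cst_continuous].
apply: compact_closed; first exact: valuation_hausdorff.
apply: continuous_compact steps_compact; apply: continuous_subspaceT.
exact: continuous_fst.
Qed.

Lemma behaviours_closed : closed behaviours.
Proof.
(* The closure is itself postfixed, hence one of the sets in the union. *)
move=> t Ct; exists (closure behaviours) => //.
exact/closure_postfixed/behaviours_postfixed.
Qed.

Lemma behaviours_lawful t : behaviours t -> lawful t.
Proof. by move=> /behaviours_postfixed[]. Qed.

Lemma behaviours_compact : compact behaviours.
Proof.
apply: (subclosed_compact behaviours_closed cube_compact) => t.
by move=> /behaviours_lawful[].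
Qed.

(** * The coalgebra structure on the space of behaviours *)

Definition cofree_space : topologicalType := behaviours.

Definition ev f (x : cofree_space) : R := (set_val x : valuation) f.

Lemma cofree_hausdorff : hausdorff_space cofree_space.
Proof. exact/set_type_hausdorff/valuation_hausdorff. Qed.

Lemma cofree_compact : compact [set: cofree_space].
Proof. exact/set_type_compact/behaviours_compact. Qed.

Lemma ev_continuous f : continuous (ev f).
Proof.
move=> x; apply: (@continuous_comp _ valuation R set_val (fun t => t f)).
  exact: set_val_continuous.
exact: eval_continuous.
Qed.

Lemma ev_lawful x : lawful (ev^~ x).
Proof. exact: (behaviours_lawful (set_valP x)). Qed.

Lemma ev01 f x : 0 <= ev f x <= 1.
Proof. by have [] := ev_lawful x. Qed.

Lemma ev_inj x y : (forall f, ev f x = ev f y) -> x = y.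
Proof. by move=> xy; apply: val_inj; apply: funext => f; exact: xy. Qed.

Definition cofree_rel := [set p : cofree_space * cofree_space |
  forall f, ev f p.2 <= ev (Dia f) p.1].

Lemma cofree_rel_closed : closed cofree_rel.
Proof.
rewrite (_ : cofree_rel = \bigcap_f [set p | ev f p.2 <= ev (Dia f) p.1]).
  apply: closed_bigI => f _; apply: closed_le_fun.
    exact: (continuous_comp_snd (@ev_continuous f)).
  exact: (continuous_comp_fst (@ev_continuous (Dia f))).
by apply/seteqP; split => p pf f; [move=> _|]; exact: pf.
Qed.

Lemma cofree_succ_closed x : closed [set y | cofree_rel (x, y)].
Proof.
rewrite (_ : mkset _ = \bigcap_f [set y | ev f y <= ev (Dia f) x]).
  apply: closed_bigI => f _; apply: closed_le_fun; first exact: ev_continuous.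
  exact: cst_continuous.
by apply/seteqP; split => p pf f; [move=> _|]; exact: pf.
Qed.

Definition cofree_str (x : cofree_space) : vietoris cofree_space :=
  exist _ [set y | cofree_rel (x, y)] (@cofree_succ_closed x).

Lemma ev_Dia_attained f x : 0 < ev (Dia f) x ->
  exists2 y, cofree_rel (x, y) & ev f y = ev (Dia f) x.
Proof.
move=> p0; have [_ /(_ f)[e|]] := behaviours_postfixed (set_valP x).
  by move: p0; rewrite [ev _ _]e ltxx.
by move=> [s [Bs xs e]]; exists (SigSub (mem_set Bs)).
Qed.

(** Successors stay below by definition of the relation; a positive value is attained at a witness,
    and otherwise nonnegativity of the supremum suffices. *)
Lemma ev_Dia f x : ev (Dia f) x = sup (ev f @` sval (cofree_str x)).
Proof.
apply/eqP; rewrite eq_le; apply/andP; split; last first.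
  by apply: sup_image_le => [|y]; [have /andP[] := ev01 (Dia f) x|exact].
have [p0|p0] := ltP 0 (ev (Dia f) x).
  have [y xy <-] := ev_Dia_attained p0.
  exact: (@sup_image_ub _ _ (sval (cofree_str x)) _ _ (ev01 f) xy).
by apply: (le_trans p0); apply: sup_image_ge0; exact: ev01.
Qed.

(** If no formula works, the sets [Phi f] with [f] of value 1 at [x] generate a proper filter on
    [K]. By compactness it has a cluster point y in [K], where all these formulas are at least 1/2,
    and [Tent] then forces y = x. *)
Lemma ev_separates (K : set cofree_space) x : closed K -> ~ K x ->
  exists f, ev f x = 1 /\ forall y, K y -> ev f y < 2^-1.
Proof.
move=> cK nKx; apply: contrapT => nf.
pose Phi f := [set y | K y /\ 2^-1 <= ev f y].
have PF : ProperFilter (filter_from [set f | ev f x = 1] Phi).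
  apply: filter_from_proper.
    apply: filter_from_filter; first by exists Top; have [] := ev_lawful x.
    move=> f g /= fx gx; exists (Min f g).
      by have [_ _ /(_ f g) e _] := ev_lawful x; rewrite /= e fx gx minxx.
    move=> y [Ky]; have [_ _ -> _] := ev_lawful y.
    by rewrite le_min => /andP[].
  move=> f /= fx; apply: contrapT => n0; apply: nf; exists f; split => // y Ky.
  by rewrite ltNge; apply/negP => fy; apply: n0; exists y.
have KF : filter_from [set f | ev f x = 1] Phi K.
  by exists Top; [have [] := ev_lawful x|move=> y []].
have [y [Ky Fy]] := subclosed_compact cK cofree_compact (@subsetT _ K) _ KF.
have fy f : ev f x = 1 -> 2^-1 <= ev f y.
  move=> fx; apply: (@closure_sub_closed _ (Phi f) [set y | 2^-1 <= ev f y]).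
  - by move=> z [].
  - by apply: closed_le_fun; [exact: cst_continuous|exact: ev_continuous].
  - by move: Fy; rewrite clusterE; apply; exists f.
apply: nKx; rewrite (_ : x = y)//; apply: ev_inj => f; apply: contrapT => /eqP fxy.
(* This formula is 1 at [x] and 0 at [y], against the bound 1/2. *)
have := fy (Tent (ev f x) (ev f y - ev f x)^-1 f).
have [_ _ _ ->] := ev_lawful x; have [_ _ _ ->] := ev_lawful y.
rewrite tent_center tent_apart 1?eq_sym// => /(_ erefl).
by rewrite leNgt invr_gt0 ltr0n.
Qed.

Lemma cofree_str_continuous : continuous cofree_str.
Proof.
apply: continuous_vietoris => U oU.
  (* The complement of a box condition is the projection of a compact set of pairs. *)
  rewrite (_ : mkset _ = ~` (fst @` (cofree_rel `&` snd @^-1` (~` U)))).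
    apply: closed_openC; apply: closed_image.
    - by rewrite -setXTT; apply: compact_setX; exact: cofree_compact.
    - exact: cofree_hausdorff.
    - exact: continuous_fst.
    - apply: closedI; first exact: cofree_rel_closed.
      by apply: closed_preimage (open_closedC oU); exact: continuous_snd.
  apply/seteqP; split => x.
    by move=> xU [[x' y] /= [xy nUy] e]; apply: nUy; apply: xU; rewrite /= -e.
  by move=> nx y xy; apply: contrapT => nUy; apply: nx; exists (x, y).
rewrite openE => x [y [xy Uy]].
(* As [f] is 1 at [y] and below 1/2 off [U], the open condition that [Dia f] exceeds 1/2 holds at
   [x] and gives every point satisfying it a successor in [U]. *)
have [|f [fy fU]] := @ev_separates (~` U) y (open_closedC oU); first by apply.
have : nbhs x (ev (Dia f) @^-1` [set r | 2^-1 < r]).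
  apply: (@ev_continuous (Dia f) x); apply: open_nbhs_nbhs; split.
    exact: open_gt.
  apply: lt_le_trans (xy f); rewrite /= fy.
  by rewrite invf_lt1// ltr1n.
apply: filterS => z /= fz.
have [|w zw fw] := @ev_Dia_attained f z.
  by apply: lt_trans fz; rewrite invr_gt0 ltr0n.
exists w; split => //; apply: contrapT => /fU.
by rewrite fw ltNge (ltW fz).
Qed.

Definition cofree : coalg :=
  Coalg cofree_compact cofree_hausdorff cofree_str_continuous.

Definition cofree_unit (a : S) : Uob R cofree :=
  exist _ (ev (Var a)) (conj (@ev_continuous (Var a)) (ev01 (Var a))).

(** * Universal property of the cofree coalgebra *)

Section lift.
Variables (A : coalg) (phi : S -> Uob R A).

Fixpoint sem f : cX A -> R := match f with
  | Var a => sval (phi a)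
  | Top => cst 1
  | Min f g => fun x => Num.min (sem f x) (sem g x)
  | Tent r e f => fun x => tent r e (sem f x)
  | Dia f => fun x => sup (sem f @` sval (cstr x))
  end.

Lemma sem01 f x : 0 <= sem f x <= 1.
Proof.
elim: f x => [a||f IHf g IHg|r e f IHf|f IHf] x /=.
- by have [] := svalP (phi a).
- by rewrite ler01 lexx.
- exact: min01.
- exact: tent01.
- exact: sup_image01.
Qed.

Lemma sem_continuous f : continuous (sem f).
Proof.
elim: f => [a||f IHf g IHg|r e f IHf|f IHf] /=.
- by have [] := svalP (phi a).
- exact: cst_continuous.
- by move=> x; apply: (@continuous_min R _ (sem f)); [exact: IHf|exact: IHg].
- by move=> x; apply: continuous_comp; [exact: IHf|exact: tent_continuous].
- by apply: sup_image_continuous; [exact: cstr_cont|exact: IHf|exact: sem01].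
Qed.

Lemma cstr_compact (x : cX A) : compact (sval (cstr x)).
Proof. exact: (subclosed_compact (svalP (cstr x)) (@cX_compact A)). Qed.

(** Successor sets are compact and formulas continuous, so a positive supremum is attained, and the
    theory of a maximizing successor is a witness. *)
Lemma theory_postfixed : postfixed (range (fun x : cX A => sem^~ x : valuation)).
Proof.
move=> _ [x _ <-]; split.
  by split => // f; exact: sem01.
move=> f; have [p0|p0] := leP (sem (Dia f) x) 0.
  by left; apply/eqP; rewrite eq_le p0; have /andP[] := sem01 (Dia f) x.
have [y xy e] := sup_image_attained (@cstr_compact x)
  (@sem_continuous f) (sem01 f) p0.
right; exists (sem^~ y); split => // g; exact: (sup_image_ub (sem01 g) xy).
Qed.

Lemma theory_behaviours (x : cX A) : behaviours (sem^~ x).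
Proof. by exists (range (fun x : cX A => sem^~ x : valuation));
  [exact: theory_postfixed|exists x]. Qed.

Definition theory (x : cX A) : cofree_space := SigSub (mem_set (theory_behaviours x)).

Lemma theory_continuous : continuous theory.
Proof.
apply: continuous_set_val; apply: continuous_prod => f; exact: sem_continuous.
Qed.

(** Theories of successors are successors because values are bounded by suprema. Conversely, a
    successor of [theory x] outside the closed image of the successors of [x] has value 1 for some
    [f] that is below 1/2 on that image, so [Dia f] is at most 1/2 at [x], a contradiction. *)
Lemma theory_mor : @coalg_mor A cofree theory.
Proof.
split; first exact: theory_continuous.
move=> x; apply/seteqP; split => [_ [y xy <-] f|y xy].
  exact: (sup_image_ub (sem01 f) xy).
apply: contrapT => ny.
have [|f [fy fx]] := ev_separates _ ny.
  by apply: closed_image theory_continuous _; [exact: cX_compact|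
    exact: cofree_hausdorff|exact: svalP].
have := xy f; rewrite /= fy leNgt => /negP; apply.
apply: (@le_lt_trans _ _ 2^-1); last by rewrite invf_lt1// ltr1n.
apply: sup_image_le => [|z xz]; first by rewrite invr_ge0.
by apply: ltW; apply: (fx (theory z)); exists z.
Qed.

Definition cofree_lift : Defs.hom A cofree := exist _ theory theory_mor.

Lemma cofree_lift_unit : Umor cofree_lift \o cofree_unit =1 phi.
Proof. by move=> a; exact: Uob_ext. Qed.

(** Formulas separate points, and their values are forced by induction; for [Dia], the value is a
    supremum over successors, which a morphism maps onto successors. *)
Lemma cofree_lift_unique (g : Defs.hom A cofree) :
  Umor g \o cofree_unit =1 phi -> sval g = sval cofree_lift.
Proof.
move=> gphi; apply: funext => x; apply: ev_inj => f.
rewrite [RHS]/(sem f x); elim: f x => [a||f IHf h IHh|r e f IHf|f IHf] x /=.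
- by rewrite -gphi.
- by have [] := ev_lawful (sval g x).
- by have [_ _ -> _] := ev_lawful (sval g x); rewrite IHf IHh.
- by have [_ _ _ ->] := ev_lawful (sval g x); rewrite IHf.
- have [_ gmor] := svalP g; rewrite ev_Dia.
  rewrite (_ : sval _ = sval g @` sval (cstr x)); last by rewrite gmor.
  by rewrite image_comp; congr sup; apply: eq_imagel => y _; exact: IHf.
Qed.

End lift.
End cofree.

(** * Closed sets stable under successors as subcoalgebras *)

Section subcoalgebra.
Variables (B : coalg) (K : set (cX B)).
Hypotheses (cK : closed K)
  (K_inv : forall x, K x -> sval (cstr x) `<=` K).

Lemma sub_str_closed (x : K) :
  closed [set y : K | sval (cstr (set_val x)) (set_val y)].
Proof.
exact: (closed_preimage (@set_val_continuous _ K) (svalP (cstr (set_val x)))).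
Qed.

Definition sub_str (x : K) : vietoris K := exist _ _ (@sub_str_closed x).

Lemma sub_str_image (x : K) : set_val @` sval (sub_str x) = sval (cstr (set_val x)).
Proof.
apply/seteqP; split => [_ [y xy <-] //|y xy].
by exists (SigSub (mem_set (K_inv (set_valP x) xy))).
Qed.

Lemma sub_str_continuous : continuous sub_str.
Proof.
have cc : continuous (fun x : K => cstr (set_val x)).
  by move=> x; apply: continuous_comp;
    [exact: set_val_continuous|exact: cstr_cont].
apply: continuous_vietoris => _ [U oU <-].
  rewrite (_ : mkset _ = (fun x : K => cstr (set_val x)) @^-1`
      [set L : vietoris (cX B) | sval L `<=` U]).
    by move/continuousP: cc; apply; exact: open_box.
  apply/seteqP; split => x xU y xy.
    have [z xz <-] : (set_val @` sval (sub_str x)) y by rewrite sub_str_image.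
    exact: xU.
  exact: xU.
rewrite (_ : mkset _ = (fun x : K => cstr (set_val x)) @^-1`
    [set L : vietoris (cX B) | sval L `&` U !=set0]).
  by move/continuousP: cc; apply; exact: open_diamond.
apply/seteqP; split => x [y [xy Uy]]; last first.
  have [z xz zy] : (set_val @` sval (sub_str x)) y by rewrite sub_str_image.
  by exists z; split => //; rewrite /preimage/= zy.
by exists (set_val y).
Qed.

Definition subcoalg : coalg := Coalg
  (set_type_compact (subclosed_compact cK (@cX_compact B) (@subsetT _ K)))
  (set_type_hausdorff (@cX_hausdorff B)) sub_str_continuous.

Definition subcoalg_incl : Defs.hom subcoalg B :=
  exist _ set_val (conj (@set_val_continuous _ K) sub_str_image).

End subcoalgebra.

Lemma coalg_mor_comp (A B C : coalg) (f : Defs.hom A B) (g : Defs.hom B C) :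
  @coalg_mor A C (sval g \o sval f).
Proof.
have [[fc fm] [gc gm]] := (svalP f, svalP g); split => [x|x].
  by apply: continuous_comp; [exact: fc|exact: gc].
by rewrite -image_comp fm gm.
Qed.

Definition hom_comp (A B C : coalg) (g : Defs.hom B C) (f : Defs.hom A B) :
  Defs.hom A C := exist _ (sval g \o sval f) (coalg_mor_comp f g).

Lemma coalg_mor_id (A : coalg) : @coalg_mor A A id.
Proof. by split => [x|x]; [exact: cvg_id|rewrite image_id]. Qed.

Definition hom_id (A : coalg) : Defs.hom A A := exist _ id (coalg_mor_id A).

(** * Faithfulness, and extension of functions along injections *)

Section monadicity.
Variable R : realType.
Implicit Types A B C : coalg.

Lemma Uob_separates A (x y : cX A) :
  (forall h : Uob R A, sval h x = sval h y) -> x = y.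
Proof.
move=> hxy; apply: contrapT => nxy.
have [h [hc h01 h0 h1]] := @urysohn01 R _ (@cX_compact A) (@cX_hausdorff A)
  [set y] x (closed_set1_hausdorff (@cX_hausdorff A)) nxy.
have /= := hxy (exist _ h (conj hc h01)).
by rewrite h1 h0// => /eqP; rewrite oner_eq0.
Qed.

Lemma Umor_comp A B C (f : Defs.hom A B) (g : Defs.hom B C) (h : Uob R C) :
  Umor (hom_comp g f) h = Umor f (Umor g h).
Proof. exact: Uob_ext. Qed.

Lemma Umor_faithful A B (g1 g2 : Defs.hom B A) :
  @Umor R _ _ g1 =1 @Umor R _ _ g2 -> sval g1 = sval g2.
Proof.
move=> g12; apply: funext => x; apply: Uob_separates => h.
by have := g12 h; move/(congr1 (fun k => sval k x)).
Qed.

Lemma Umor_extension A B (i : Defs.hom A B) (h : Uob R A) : injective (sval i) ->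
  exists h' : Uob R B, Umor i h' = h.
Proof.
move=> ii; have [ic _] := svalP i; have [hc h01] := svalP h.
have [h' [h'c h'01 h'i]] := extension01 (@cX_compact B) (@cX_hausdorff B)
  (@cX_compact A) ic ii hc h01.
by exists (exist _ h' (conj h'c h'01)); exact: Uob_ext.
Qed.

(** * Equalizers of coreflexive pairs *)

Section coreflexive_equalizer.
Variables (B D : coalg) (u v : Defs.hom B D) (r : cX D -> cX B).
Hypotheses (rc : continuous r) (ru : cancel (sval u) r) (rv : cancel (sval v) r).

Definition equalizer_set := [set x | sval u x = sval v x].

Lemma equalizer_closed : closed equalizer_set.
Proof.
have [[uc _] [vc _]] := (svalP u, svalP v).
rewrite (_ : equalizer_set =
    \bigcap_(h : Uob R D) [set x | sval h (sval u x) = sval h (sval v x)]).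
  apply: closed_bigI => h _; have [hc _] := svalP h.
  by apply: closed_eq_fun => x; apply: continuous_comp;
    [exact: uc|exact: hc|exact: vc|exact: hc].
apply/seteqP; split => x; first by move=> + h _ /= => ->.
by move=> ex; apply: Uob_separates => h; exact: ex.
Qed.

(** For a successor [y] of [x], the point u y is a successor of u x = v x, so u y = v z for some
    successor z of [x]; applying [r] gives y = z. *)
Lemma equalizer_inv x : equalizer_set x -> sval (cstr x) `<=` equalizer_set.
Proof.
have [[_ um] [_ vm]] := (svalP u, svalP v).
move=> ex y xy; have : sval (cstr (sval u x)) (sval u y) by rewrite -um; exists y.
by rewrite ex -vm => -[z _] zy; rewrite /equalizer_set/= -zy -{1}(rv z) zy ru.
Qed.

(* Any [h] and [k] agreeing on the equalizer glue to a function on the union of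
   the images of [u] and [v], which extends to [D] by Tietze's theorem. *)
Lemma coequalized (h k : Uob R B) :
  (forall x, equalizer_set x -> sval h x = sval k x) ->
  exists H : Uob R D, Umor u H = h /\ Umor v H = k.
Proof.
move=> hk; have [[uc _] [vc _]] := (svalP u, svalP v).
have [[hc h01] [kc k01]] := (svalP h, svalP k).
pose f z := if `[< range (sval u) z >] then sval h (r z) else sval k (r z).
have clr (g : Defs.hom B D) : closed (range (sval g)).
  have [gc _] := svalP g.
  exact: closed_image (@cX_compact B) (@cX_hausdorff D) gc closedT.
have fu x : f (sval u x) = sval h x.
  by rewrite /f asboolT ?ru//; exists x.
have fv x : f (sval v x) = sval k x.
  rewrite /f; case: asboolP => [[y _ uv]|_]; rewrite rv//; apply: hk.
  (* Applying [r] shows that a common point of the two images comes from a single point, which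
     therefore lies in the equalizer. *)
  have yx : y = x by rewrite -(ru y) uv rv.
  by rewrite /equalizer_set/= -uv yx.
have [|x _|H [Hc H01 Hf]] := tietze01 (f := f) (@cX_compact D) (@cX_hausdorff D)
  (closedU (clr u) (clr v)).
- apply: withinU_continuous; [exact: clr|exact: clr| |].
  + apply: (@subspace_eq_continuous _ _ _ (sval h \o r)).
      by move=> z; rewrite inE => -[x _ <-]; rewrite /= ru -fu.
    apply: continuous_subspaceT => z.
    by apply: continuous_comp; [exact: rc|exact: hc].
  + apply: (@subspace_eq_continuous _ _ _ (sval k \o r)).
      by move=> z; rewrite inE => -[x _ <-]; rewrite /= rv -fv.
    apply: continuous_subspaceT => z.
    by apply: continuous_comp; [exact: rc|exact: kc].
- by rewrite /f; case: ifP => _; [exact: h01|exact: k01].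
exists (exist _ H (conj Hc H01)); split; apply: Uob_ext => x /=.
  by rewrite Hf ?fu//; left; exists x.
by rewrite Hf ?fv//; right; exists x.
Qed.

End coreflexive_equalizer.

(** * Calculus of induced morphisms *)

Local Notation F S := (cofree R S).
Local Notation T S := (Uob R (cofree R S)).
Local Notation eta := (@cofree_unit R _).
Local Notation lift := (@cofree_lift R _ _).

Lemma lift_eta S A (phi : S -> Uob R A) s : Umor (lift phi) (eta s) = phi s.
Proof. exact: cofree_lift_unit. Qed.

Lemma hom_cofree_ext S A (g1 g2 : Defs.hom A (F S)) :
  (forall s, Umor g1 (eta s) = Umor g2 (eta s)) -> sval g1 = sval g2.
Proof.
move=> g12; rewrite (@cofree_lift_unique _ _ _ (fun s => Umor g2 (eta s)) g1)//.
by rewrite -(@cofree_lift_unique _ _ _ _ g2).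
Qed.

Lemma lift_fusion S A B (g : Defs.hom A B) (psi : S -> Uob R B) (H : T S) :
  Umor g (Umor (lift psi) H) = Umor (lift (fun s => Umor g (psi s))) H.
Proof.
rewrite -Umor_comp; apply: Uob_ext => x; congr (sval H _); congr (_ x).
by apply: hom_cofree_ext => s; rewrite Umor_comp !lift_eta.
Qed.

Lemma lift_map S S' A (p : S -> S') (phi : S' -> Uob R A) (H : T S) :
  Umor (lift phi) (Umor (lift (eta \o p)) H) = Umor (lift (phi \o p)) H.
Proof.
rewrite lift_fusion; congr (Umor (lift _) H).
by apply: funext => s; rewrite /= lift_eta.
Qed.

(** * Fullness of the comparison functor *)

Lemma Umor_full A B (p : Uob R A -> Uob R B) :
  p \o Umor (lift id) =1 Umor (lift id) \o Umor (lift (eta \o p)) ->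
  exists g : Defs.hom B A, @Umor R _ _ g =1 p.
Proof.
(* [j] is the counit at [A], read in coalgebras, and [l] corresponds to [p]. For [p] to be an
   algebra morphism means that [p] after restriction along [j] is restriction along [l]. *)
pose j := lift (@id (Uob R A)); pose l := lift p.
move=> palg; have {}palg H : p (Umor j H) = Umor l H.
  by have /= -> := palg H; rewrite lift_map.
have [[jc jm] [lc lm]] := (svalP j, svalP l).
have j_inj : injective (sval j).
  move=> x y xy; apply: Uob_separates => h; rewrite -(lift_eta id h).
  exact: (congr1 (sval (eta h)) xy).
(* Otherwise a Urysohn function [H] vanishes on the range of [j] but not at [l x]. Then [H] and the
   zero function [Z] agree along [j], hence, applying [p], along [l], which is absurd at [x]. *)
have lj x : range (sval j) (sval l x).
  apply: contrapT => nx.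
  have cj : closed (range (sval j)).
    exact: closed_image (@cX_compact A) (@cX_hausdorff _) jc closedT.
  have [h [hc h01 h0 h1]] :=
    @urysohn01 R _ (@cX_compact _) (@cX_hausdorff _) _ _ cj nx.
  pose H : T (Uob R A) := exist _ h (conj hc h01).
  have c01 : forall x : cX (F (Uob R A)), 0 <= cst (0 : R) x <= 1.
    by move=> y; rewrite lexx ler01.
  pose Z : T (Uob R A) := exist _ (cst 0) (conj (@cst_continuous _ _ 0) c01).
  have : Umor l H = Umor l Z.
    rewrite -!palg; congr p; apply: Uob_ext => y /=.
    by rewrite h0//; exists y.
  by move/(congr1 (fun k => sval k x)) => /= /eqP; rewrite h1 oner_eq0.
pose g x := sval (cid2 (lj x)).
have jg x : sval j (g x) = sval l x by rewrite /g; case: cid2.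
(* Since [j] is closed and injective, continuity and the morphism law for [g] follow from those for
   [l]. *)
have gc : continuous g.
  apply/continuous_closedP => C cC.
  rewrite (_ : _ @^-1` _ = sval l @^-1` (sval j @` C)).
    apply: closed_preimage => //.
    exact: closed_image (@cX_compact A) (@cX_hausdorff _) jc cC.
  apply/seteqP; split => x; first by move=> Cx; exists (g x).
  move=> [y Cy yx]; have gxy : g x = y by apply: j_inj; rewrite jg.
  by rewrite /preimage/= gxy.
have gm x : g @` sval (cstr x) = sval (cstr (g x)).
  have : sval j @` (g @` sval (cstr x)) = sval j @` sval (cstr (g x)).
    rewrite jm jg -lm image_comp; apply: eq_imagel => y _; exact: jg.
  move=> e; apply/seteqP; split => y yx.
    have : (sval j @` (g @` sval (cstr x))) (sval j y) by exists y.
    by rewrite e => -[z zx /j_inj <-].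
  have : (sval j @` sval (cstr (g x))) (sval j y) by exists y.
  by rewrite -e => -[z zx /j_inj <-].
exists (exist _ g (conj gc gm)) => h; apply: Uob_ext => x /=.
rewrite -(lift_eta p h) -[in LHS](lift_eta id h).
exact: (congr1 (sval (eta h)) (jg x)).
Qed.

(** * Every algebra comes from a coalgebra *)

Section algebra.
Variables (Y : Type) (a : T Y -> Y).
Hypotheses (a_unit : forall y, a (eta y) = y)
  (a_assoc : forall H : T (T Y),
     a (Umor (lift (eta \o a)) H) = a (Umor (lift id) H)).

(** Under [Umor], the maps [u], [v] and [r] become the multiplication, T a and T eta: the canonical
    reflexive pair presenting the algebra, with its common section. *)
Let u : Defs.hom (F Y) (F (T Y)) := lift id.
Let v : Defs.hom (F Y) (F (T Y)) := lift (eta \o a).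
Let r : Defs.hom (F (T Y)) (F Y) := lift (eta \o eta).

Lemma alg_retract_u : cancel (sval u) (sval r).
Proof.
move=> x; suff : sval (hom_comp r u) = sval (hom_id (F Y)) by move/(congr1 (@^~ x)).
apply: hom_cofree_ext => y; rewrite Umor_comp !lift_eta.
exact: Uob_ext.
Qed.

Lemma alg_retract_v : cancel (sval v) (sval r).
Proof.
move=> x; suff : sval (hom_comp r v) = sval (hom_id (F Y)) by move/(congr1 (@^~ x)).
apply: hom_cofree_ext => y; rewrite Umor_comp !lift_eta /= a_unit.
exact: Uob_ext.
Qed.

Let K := equalizer_set u v.
Let A := subcoalg (@equalizer_closed _ _ u v)
  (@equalizer_inv _ _ u v _ alg_retract_u alg_retract_v).
Let i : Defs.hom A (F Y) := subcoalg_incl _ _.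

(** Functions agreeing on the equalizer are the images of one [H] under the multiplication and T a,
    which [a] identifies by associativity. Conversely, any g agrees there with eta (a g), these
    being the restrictions of eta g along [u] and [v]. *)
Lemma alg_restrict (h k : T Y) : (Umor i h = Umor i k) <-> a h = a k.
Proof.
split => [hk|].
  have [|H [<- <-]] := @coequalized _ _ u v _ (svalP r).1 alg_retract_u alg_retract_v h k.
    move=> x Kx.
    exact: (congr1 (fun g => sval g (SigSub (mem_set Kx) : cX A)) hk).
  by rewrite -a_assoc.
have ia (g : T Y) : Umor i g = Umor i (eta (a g)).
  rewrite -[in LHS](lift_eta id g) -[eta (a g)](lift_eta (eta \o a) g).
  apply: Uob_ext => x; exact: (congr1 (sval (eta g)) (set_valP x)).
by move=> hk; rewrite ia hk -ia.
Qed.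

(** Restriction to [A] and [a] are surjections from T Y with the same kernel, so their targets are
    in bijection: extend and apply [a], or restrict a generator. *)
Lemma alg_coalg : exists (A : coalg) (p : Uob R A -> Y) (q : Y -> Uob R A),
  cancel p q /\ cancel q p /\
  p \o Umor (lift id) =1 a \o Umor (lift (eta \o p)).
Proof.
have i_inj : injective (sval i) by exact: val_inj.
pose e (g : Uob R A) : T Y := sval (cid (Umor_extension g i_inj)).
have ie g : Umor i (e g) = g by rewrite /e; case: cid.
have iea g : Umor i (eta (a (e g))) = g.
  by rewrite -[RHS]ie; apply/alg_restrict; rewrite a_unit.
exists A, (a \o e), (fun y => Umor i (eta y)); split; first exact: iea.
split => [y|H] /=; first by rewrite -[RHS]a_unit; apply/alg_restrict; rewrite ie.
(* Equality under [a] is checked after restriction to [A], where both sides are induced by the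
   identity. *)
apply/alg_restrict; rewrite ie lift_fusion; congr (Umor (lift _) H).
by apply: funext => g; rewrite /= iea.
Qed.

End algebra.
End monadicity.

Theorem theorem2p8 (R : realType) : U_monadic R.
Proof.
exists (cofree R), (@cofree_unit R), (@cofree_lift R).
split; first exact: cofree_lift_unit.
split; first exact: cofree_lift_unique.
split; first exact: Umor_faithful.
split; first exact: Umor_full.
move=> Y a [a_unit a_assoc]; exact: alg_coalg.
Qed.
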